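(* Let $(W,S)$ be a right-angled Coxeter system of type $\Gamma$. For every $\psi\in\mathrm{Aut}(\mathcal N,R_{\mathcal P},\mathrm{Card})$ the permutation $\sigma_\psi$ of $S$ belongs to $\mathrm{Aut}(\Gamma)$. Moreover the map $\psi\mapsto\sigma_\psi$ is a group homomorphism and a section of $\theta$. In particular $G=\{\sigma_\psi\mid\psi\in\mathrm{Aut}(\mathcal N,R_{\mathcal P},\mathrm{Card})\}$ is a subgroup of $\mathrm{Aut}(\Gamma)$ and one has the (internal) semidirect product decompositions $$\mathrm{Aut}([S],[S]_c)=K(\Gamma)\rtimes G\quad\text{and}\quad \mathrm{Aut}(\Gamma)=(K(\Gamma)\cap\mathrm{Aut}(\Gamma))\rtimes G.$$
   Context: $(W,S)$ is a right-angled Coxeter system (arbitrary rank): $W$ is generated by the set $S$ of elements of order $2$, with $m_{s,t}\in\{1,2,\infty\}$ the order of $st$, and $W=\langle S\mid (st)^{m_{s,t}}=1,\ m_{s,t}\ne\infty\rangle$; $\Gamma=(m_{s,t})_{s,t\in S}$. For $X\subseteq S$, $C(X)=\{y\in S\mid\forall x\in X,\ xy=yx\}$, $C^2=C\circ C$, $C^2(s)=C^2(\{s\})$. Kernels are the equivalence classes on $S$ for $C^2(s)=C^2(t)$; $\mathcal N$ is the set of kernels (a partition of $S$); for $N\in\mathcal N$, $\mathrm{Cel}(N)=C^2(s)$ for any $s\in N$. For $X,Y\subseteq S$, $XR_{\mathcal P}Y$ means every element of $X$ commutes with every element of $Y$. $\mathrm{Aut}(\mathcal N,R_{\mathcal P},\mathrm{Card})$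 is the group of permutations $\psi$ of $\mathcal N$ such that $N R_{\mathcal P}P\iff\psi(N)R_{\mathcal P}\psi(P)$ and $\mathrm{Card}(\psi(N))=\mathrm{Card}(N)$ for all $N,P\in\mathcal N$. $[S]$ is the $\mathbb F_2$-vector space of finite subsets of $S$ (addition is symmetric difference), $[T]$ the subspace of finite subsets of $T\subseteq S$, $[S]_c$ the set of finite subsets of $S$ with pairwise commuting elements; $\mathrm{Aut}([S],[S]_c)$ is the group of linear automorphisms $\varphi$ of $[S]$ with $\varphi([S]_c)=[S]_c$. Every $\varphi\in\mathrm{Aut}([S],[S]_c)$ induces $\varphi_{\mathcal N}\in\mathrm{Aut}(\mathcal N,R_{\mathcal P},\mathrm{Card})$, where $\varphi_{\mathcal N}(N)=N'$ is the kernel with $\varphi([\mathrm{Cel}(N)])=[\mathrm{Cel}(N')]$. $\theta:\mathrm{Aut}([S],[S]_c)\to\mathrm{Aut}(\mathcal N,R_{\mathcal P},\mathrm{Card})$, $\varphi\mapsto\varphi_{\mathcal N}$, is a group homomorphism and $K(\Gamma)=\ker\theta$. $\mathrm{Aut}(\Gamma)$ is the group of permutations $\sigma$ of $S$ with $m_{\sigma(s),\sigma(t)}=m_{s,t}$ for all $s,t\in S$; it is identified with a subgroup of $\mathrm{Aut}([S],[S]_c)$ via $\sigma\mapsto(X\mapsto\sigma(X))$. Let $\Omega$ be the set of equivalence classes of $\mathcal N$ for the relation $\mathrm{Card}(N)=\mathrm{Card}(P)$. For each $\omega\in\Omega$ fix once and for all a representative $N_\omega\in\omega$ and, for each $N\in\omega$,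 a bijection $\sigma_{\omega,N}:N_\omega\to N$. For $\psi\in\mathrm{Aut}(\mathcal N,R_{\mathcal P},\mathrm{Card})$, $\sigma_\psi$ is the permutation of $S$ whose restriction to each kernel $N$, with $N\in\omega$, is $\sigma_{\omega,\psi(N)}\circ(\sigma_{\omega,N})^{-1}:N\to\psi(N)$. In $A\rtimes B$, $A$ is the normal factor. *)

(* Defs.v *)
From HB Require Import structures.
From mathcomp Require Import all_boot all_algebra.
From mathcomp Require Import all_classical.

Set Implicit Arguments.
Unset Strict Implicit.
Unset Printing Implicit Defensive.

(******************************************************************************)
(* Correspondence with the usual notation, for a right-angled Coxeter system  *)
(* (W, S):                                                                    *)
(*        cox_mx s t  m_{s,t}, with 0 for infinity                            *)
(*           Cent X   C(X)                                                    *)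
(*           kernel S the set of kernels, as a type of nonempty subsets of S  *)
(*      kernel_at s   the kernel containing s                                 *)
(*         autN S     Aut(N, R_P, Card)                                       *)
(*       finsub S     the vector space [S] over F_2                           *)
(*    finsub_in U     its subspace [U]                                        *)
(*     cliques S      [S]_c                                                   *)
(* Aut_cliques S      Aut([S], [S]_c)                                         *)
(*   Aut_Gamma S      Aut(Gamma), inside the permutations of S                *)
(* sym_finsub s       the image of s under the inclusion of Aut(Gamma) into   *)
(*                    Aut([S], [S]_c)                                         *)
(* All groups of permutations are subsets of the group sym T of permutations  *)
(* of a type T, whose product is composition.                                 *)
(******************************************************************************)

Import GRing.Theory.

Local Open Scope classical_set_scope.
Local Open Scope card_scope.
Local Open Scope group_scope.

(* The order of an element of a group; 0 encodes an infinite order. *)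
Definition elt_order (G : groupType) (x : G) : nat :=
  if pselect (exists n, (0 < n)%N && (x ^+ n == 1)) is left ex_n
  then ex_minn ex_n else 0%N.

Definition subgroup (G : groupType) (A : set G) : Prop := group_closed [in A].

(* A is the internal semidirect product of its normal subgroup N and its      *)
(* subgroup H.                                                                *)
Definition internal_sdprod (G : groupType) (A N H : set G) : Prop :=
  [/\ [/\ subgroup A, subgroup N & subgroup H],
      N `<=` A /\ H `<=` A,
      forall a n, A a -> N n -> N (n ^ a),
      N `&` H = [set 1]
    & A = [set n * h | n in N & h in H]].

(* Permutations of a possibly infinite type. The inverse is part of the data, *)
(* but it is determined by the underlying function.                           *)
Record sym (T : Type) := Sym {
  sym_fun :> T -> T;
  sym_inv : T -> T;
  sym_funK : cancel sym_fun sym_inv;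
  sym_invK : cancel sym_inv sym_fun }.

Section Sym.
Variable T : Type.
Implicit Types f g h : sym T.

Lemma symP f g : f =1 g -> f = g.
Proof.
case: f g => [f f' fK f'K] [g g' gK g'K] /= fg.
have {fg} fg : f = g by apply/funext.
subst g.
have gf' : g' = f' by apply/funext => x; rewrite -{1}(f'K x) gK.
by subst g'; congr Sym; exact: Prop_irrelevance.
Qed.

HB.instance Definition _ := gen_eqMixin (sym T).
HB.instance Definition _ := gen_choiceMixin (sym T).

Definition sym_one : sym T := @Sym T id id (fun=> erefl) (fun=> erefl).
Definition sym_mul f g : sym T :=
  Sym (can_comp (sym_funK f) (sym_funK g)) (can_comp (sym_invK g) (sym_invK f)).
Definition sym_opp f : sym T := Sym (sym_invK f) (sym_funK f).

Fact sym_mulA : associative sym_mul. Proof. by move=> f g h; exact: symP. Qed.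
Fact sym_mul1 : left_id sym_one sym_mul. Proof. by move=> f; exact: symP. Qed.
Fact sym_mulr1 : right_id sym_one sym_mul. Proof. by move=> f; exact: symP. Qed.
Fact sym_mulV : left_inverse sym_one sym_opp sym_mul.
Proof. by move=> f; apply: symP => x /=; rewrite sym_funK. Qed.
Fact sym_mulrV : right_inverse sym_one sym_opp sym_mul.
Proof. by move=> f; apply: symP => x /=; rewrite sym_invK. Qed.

HB.instance Definition _ := isGroup.Build (sym T)
  sym_mulA sym_mul1 sym_mulr1 sym_mulV sym_mulrV.

Lemma sym_mulE f g x : (f * g) x = f (g x). Proof. by []. Qed.
Lemma symVK f x : f (f^-1 x) = x. Proof. exact: sym_invK. Qed.
Lemma symKV f x : f^-1 (f x) = x. Proof. exact: sym_funK. Qed.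

End Sym.

Section FiniteSubsets.
Variable T : Type.

Definition finsub := set_type [set X : set T | finite_set X].
HB.instance Definition _ := Choice.on finsub.
HB.instance Definition _ := SubType.on finsub.

Implicit Types X Y : finsub.

Lemma finsubP X : finite_set (val X).
Proof. exact: set_mem (valP X). Qed.

Definition Finsub (X : set T) (finX : finite_set X) : finsub :=
  exist _ X (mem_set finX).

Lemma finite_setY (X Y : set T) :
  finite_set X -> finite_set Y -> finite_set (X `+` Y).
Proof.
by move=> fX fY; rewrite setY_def finite_setU; split; apply: finite_setD.
Qed.

Definition finsub_add X Y := Finsub (finite_setY (finsubP X) (finsubP Y)).
Definition finsub_zero := Finsub (@finite_set0 T).

Fact finsub_addA : associative finsub_add.
Proof. by move=> X Y Z; apply: val_inj; rewrite /= setYA. Qed.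
Fact finsub_addC : commutative finsub_add.
Proof. by move=> X Y; apply: val_inj; rewrite /= setYC. Qed.
Fact finsub_add0 : left_id finsub_zero finsub_add.
Proof. by move=> X; apply: val_inj; rewrite /= set0Y. Qed.
Fact finsub_addN : left_inverse finsub_zero id finsub_add.
Proof. by move=> X; apply: val_inj; rewrite /= setYK. Qed.

HB.instance Definition _ := GRing.isZmodule.Build finsub
  finsub_addA finsub_addC finsub_add0 finsub_addN.

Definition finsub_scale (a : 'F_2) X : finsub := if a == 0%R then 0%R else X.

Fact finsub_scaleA a b X :
  finsub_scale a (finsub_scale b X) = finsub_scale (a * b)%R X.
Proof. by rewrite /finsub_scale mulf_eq0; case: eqP; case: eqP. Qed.
Fact finsub_scale1 : left_id 1%R finsub_scale.
Proof. by []. Qed.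
Fact finsub_scaleDr : right_distributive finsub_scale +%R.
Proof. by move=> a X Y; rewrite /finsub_scale; case: eqP; rewrite ?addr0. Qed.
Fact finsub_scaleDl X : {morph finsub_scale^~ X : a b / (a + b)%R}.
Proof.
move=> [[|[|//]] ia] [[|[|//]] ib]; rewrite /finsub_scale /= ?addr0 ?add0r //.
exact/esym/finsub_addN.
Qed.

HB.instance Definition _ := GRing.Zmodule_isLmodule.Build 'F_2 finsub
  finsub_scaleA finsub_scale1 finsub_scaleDr finsub_scaleDl.

Definition finsub_in (U : set T) : set finsub := [set X | val X `<=` U].

Definition finsub_map (s : sym T) X : finsub :=
  Finsub (finite_image s (finsubP X)).

Fact finsub_mapK (s : sym T) : cancel (finsub_map s) (finsub_map s^-1).
Proof.
move=> X; apply: val_inj; apply/seteqP; split=> [_ [_ [x Xx <-] <-]|x Xx].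
  by rewrite symKV.
by exists (s x); [exists x | rewrite symKV].
Qed.
Fact finsub_mapVK (s : sym T) : cancel (finsub_map s^-1) (finsub_map s).
Proof. by move=> X; rewrite -[X in finsub_map X](invgK s) finsub_mapK. Qed.

Definition sym_finsub (s : sym T) : sym finsub := Sym (@finsub_mapK s) (@finsub_mapVK s).

End FiniteSubsets.

Section Coxeter.
Variables (W : groupType) (S : set W).

Definition cox_mx (s t : S) : nat := elt_order (val s * val t).

(* The last clause is the universal property of the group presented by the    *)
(* generators S and the relations (s t) ^ m_{s,t} = 1 for m_{s,t} finite;     *)
(* m_{s,s} = 1 accounts for s ^ 2 = 1.                                        *)
Definition right_angled_coxeter_system : Prop :=
  [/\ forall s, S s -> elt_order s = 2,
      forall H : set W, subgroup H -> S `<=` H -> H = setT,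
      forall s t : S, cox_mx s t \in [:: 1; 2; 0]%N
    & forall (G : groupType) (f : S -> G),
        (forall s t, cox_mx s t != 0%N -> (f s * f t) ^+ cox_mx s t = 1) ->
        exists g : W -> G, monoid.monoid_morphism g /\ forall s : S, g (val s) = f s].

Definition Cent (X : set S) : set S :=
  [set y | forall x, X x -> commute (val x) (val y)].
Definition Cent2 (X : set S) : set S := Cent (Cent X).

Definition kernel_of (s : S) : set S := [set t | Cent2 [set t] = Cent2 [set s]].

Definition kernel := set_type (range kernel_of).
HB.instance Definition _ := Choice.on kernel.
HB.instance Definition _ := SubType.on kernel.
Implicit Types N P : kernel.

Definition kernel_at (s : S) : kernel :=
  exist _ (kernel_of s) (mem_set (imageT kernel_of s)).

Lemma in_kernel_at s : val (kernel_at s) s. Proof. by []. Qed.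

Lemma kernel_atP s N : val N s -> kernel_at s = N.
Proof.
case: N => /= _ /[dup]/set_mem[t _ <-] tN st; apply: val_inj => /=.
by rewrite /kernel_of; apply/funext => u /=; rewrite st.
Qed.

Lemma kernel_ex N : exists s, val N s.
Proof. by case: N => /= _ /[dup]/set_mem[t _ <-] _; exists t. Qed.

(* By CelE, this does not depend on the chosen element of N.                  *)
Definition Cel N : set S := Cent2 [set projT1 (cid (kernel_ex N))].

Lemma CelE N s : val N s -> Cel N = Cent2 [set s].
Proof.
rewrite /Cel; case: cid => /= t; case: N => /= _ /[dup]/set_mem[u _ <-] _.
by move=> /= -> ->.
Qed.

Definition RP (X Y : set S) : Prop :=
  forall x y, X x -> Y y -> commute (val x) (val y).

Definition Card_eq N P : Prop := val N #= val P.

Definition is_autN : set (sym kernel) :=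
  [set psi | (forall N P, RP (val N) (val P) <-> RP (val (psi N)) (val (psi P)))
          /\ (forall N, Card_eq (psi N) N)].

Fact is_autN_group : subgroup is_autN.
Proof.
split; first by rewrite inE; split=> // N; exact: card_eqxx.
move=> f g; rewrite !inE => -[fR fC] [gR gC]; split=> [N P|N].
  have := gR (g^-1 N) (g^-1 P); rewrite !symVK => <-; exact: fR.
apply: card_eq_trans (fC _) _.
by have := gC (g^-1 N); rewrite symVK /Card_eq card_eq_sym.
Qed.

Definition autN := set_type is_autN.
HB.instance Definition _ := SubChoice.on autN.
HB.instance Definition _ :=
  SubChoice_isSubGroup.Build (sym kernel) [in is_autN] autN is_autN_group.

Coercion autN_sym (psi : autN) : sym kernel := val psi.

Definition cliques : set (finsub S) :=
  [set X | forall x y, val X x -> val X y -> commute (val x) (val y)].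

Definition Aut_cliques : set (sym (finsub S)) :=
  [set phi | linear phi /\ phi @` cliques = cliques].

(* The permutation induced by phi on kernels is unique if it exists, because  *)
(* Cel is injective; it exists whenever phi lies in Aut_cliques.              *)
Definition theta (phi : sym (finsub S)) : autN :=
  xget 1 [set psi : autN |
    forall N, phi @` finsub_in (Cel N) = finsub_in (Cel (psi N))].

Definition K_Gamma : set (sym (finsub S)) :=
  [set phi | Aut_cliques phi /\ theta phi = 1].

Definition Aut_Gamma : set (sym S) :=
  [set s | forall x y, cox_mx (s x) (s y) = cox_mx x y].

Definition card_class N : set kernel := [set P | Card_eq P N].
Definition Omega := set_type (range card_class).
HB.instance Definition _ := SubType.on Omega.
Definition omega_of N : Omega :=
  exist _ (card_class N) (mem_set (imageT card_class N)).

(* The choices of the representatives N_omega and of the bijections           *)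
(* sigma_{omega,N}; the values of kbij omega N off N_omega are irrelevant.     *)
Record kernel_frame := KernelFrame {
  krep : Omega -> kernel;
  krep_in : forall w, val w (krep w);
  kbij : Omega -> kernel -> S -> S;
  kbij_bij : forall w N, val w N -> set_bij (val (krep w)) (val N) (kbij w N) }.

Section SigmaPsi.
Variable F : kernel_frame.

Definition sigma_fun (psi : kernel -> kernel) (s : S) : S :=
  let N := kernel_at s in let w := omega_of N in
  kbij F w (psi N) ('pinv_(fun=> s) (val (krep F w)) (kbij F w N) s).

Lemma omega_ofP (w : Omega) N : val w N -> omega_of N = w.
Proof.
case: w => /= _ /[dup]/set_mem[P _ <-] wP NP; apply: val_inj => /=.
apply/funext => Q; rewrite /card_class /Card_eq /=; apply/propext.
by have NP' := card_esym NP; split=> QN; apply: card_eq_trans QN _.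
Qed.

Lemma sigma_funE (psi : autN) (w : Omega) N x : val w N -> val (krep F w) x ->
  sigma_fun psi (kbij F w N x) = kbij F w (psi N) x.
Proof.
move=> wN wx; have bij := kbij_bij F wN.
have Nx : val N (kbij F w N x) by case: bij => + _ _; exact.
rewrite /sigma_fun (kernel_atP Nx) (omega_ofP wN) pinvKV ?inE//.
by case: bij.
Qed.

Lemma omega_aut (psi : autN) (w : Omega) N : val w N -> val w (psi N).
Proof.
move=> wN; case: (set_mem (valP psi)) => _ /(_ N) psiN.
by rewrite -(omega_ofP wN).
Qed.

Lemma kbij_ex s : exists (w : Omega) N x,
  [/\ val w N, val (krep F w) x & s = kbij F w N x].
Proof.
have wN : val (omega_of (kernel_at s)) (kernel_at s) by exact: card_eqxx.
have [_ _ /(_ s (in_kernel_at s))[x wx <-]] := kbij_bij F wN.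
by exists (omega_of (kernel_at s)), (kernel_at s), x.
Qed.

Lemma sigma_funM (psi psi' : autN) s :
  sigma_fun (psi * psi' : autN)%g s = sigma_fun psi (sigma_fun psi' s).
Proof.
have [w [N [x [wN wx ->]]]] := kbij_ex s.
by rewrite !sigma_funE //; exact: omega_aut.
Qed.

Lemma sigma_fun1 s : sigma_fun (1 : autN) s = s.
Proof.
by have [w [N [x [wN wx ->]]]] := kbij_ex s; rewrite sigma_funE.
Qed.

Fact sigma_funK (psi : autN) :
  cancel (sigma_fun psi) (sigma_fun (psi^-1%g : autN)).
Proof. by move=> s; rewrite -sigma_funM mulVg sigma_fun1. Qed.
Fact sigma_funVK (psi : autN) :
  cancel (sigma_fun (psi^-1%g : autN)) (sigma_fun psi).
Proof. by move=> s; rewrite -sigma_funM mulgV sigma_fun1. Qed.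

Definition sigma (psi : autN) : sym S := Sym (@sigma_funK psi) (@sigma_funVK psi).

End SigmaPsi.
End Coxeter.

Arguments cliques {W} S _.
Arguments Aut_cliques {W} S _.
Arguments K_Gamma {W} S _.
Arguments Aut_Gamma {W} S _.
Arguments is_autN {W} S _.

(* Main.v *)
Require Import Defs.
From mathcomp Require Import all_boot all_algebra.
From mathcomp Require Import all_classical.
From mathcomp Require wochoice.

(******************************************************************************)
(* For cliques X and Y, X + Y is a clique iff X and Y commute elementwise, so *)
(* an element phi of Aut([S], [S]_c) preserves commutation between cliques    *)
(* and maps [C^2(X)] to [C^2(phi(X))]. If phi({s}) = X, some x in X satisfies *)
(* s \in phi^-1({x}), whence C^2(X) = C^2(x); so phi permutes the spaces      *)
(* [Cel(N)] and induces a permutation of the kernels. As Cel(N) \ N is the    *)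
(* union of the cells strictly contained in Cel(N), phi induces isomorphisms  *)
(* between the quotients [Cel(N)] / [Cel(N) \ N] = [N], and a dimension       *)
(* argument valid in all cardinalities shows that it preserves Card(N). The   *)
(* semidirect products then come from theta being split by sigma.             *)
(******************************************************************************)

Set Implicit Arguments.
Unset Strict Implicit.
Unset Printing Implicit Defensive.

Import GRing.Theory.

Local Open Scope classical_set_scope.
Local Open Scope card_scope.
Local Open Scope group_scope.

(** The theorem is a split exact sequence: once [theta] is a homomorphism on [Aut_cliques] with
    section sigma, its kernel and the image of sigma form a semidirect product, in [Aut_cliques] and
    in any subgroup containing that image ([sdprod_split]). That [theta] takes its meaning in [autN]
    rests on three facts: automorphisms permute the cells ([Aut_Cel_ex]), preserve commutation of
    kernels ([Aut_kernel_RP]) and preserve their cardinals ([Aut_kernel_card], by the linear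
    comparison [finsub_quotient_card_le]). Sigma is a section because m_{s,t} records only equality
    and commutation ([cox_mxE]), and commutation of s and t depends only on their kernels
    ([RP_kernel_at]). So a permutation carrying kernels to kernels along psi lies in Aut(Gamma) and
    induces psi; the fixed bijections make the choice multiplicative. *)

(** * Well-orderings and maxima of finite sets *)

(** All is read off from unique least elements: for pairs, existence gives totality and uniqueness
    gives antisymmetry; triples give transitivity. *)
Lemma well_order_ex (T : eqType) : exists R : rel T,
  [/\ reflexive R, transitive R, antisymmetric R, total R
    & forall P : set T, P !=set0 -> exists2 z, P z & forall x, P x -> R z x].
Proof.
have [R woR] := wochoice.well_ordering_principle T; exists R.
have min (P : set T) : P !=set0 -> exists2 z, P z & forall x, P x -> R z x.
  move=> [x Px]; have [|z [[zP Rz] _]] := woR [in P].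
    by exists x; exact: mem_set.
  by exists z => [|y Py]; [exact: set_mem | apply: Rz; exact: mem_set].
have tot : total R.
  move=> x y; have [|z + Rz] := min [set x; y]; first by exists x; left.
  by case=> <-; apply/orP; [left|right]; apply: Rz; [right|left].
have refl : reflexive R by move=> x; case/orP: (tot x x).
have anti : antisymmetric R.
  move=> x y /andP[xy yx]; have [|z [_ uz]] := woR [in [set x; y]].
    by exists x; rewrite inE; left.
  transitivity z; [apply/esym|]; apply: uz.
    by split=> [|t]; rewrite inE; [left | case=> ->].
  by split=> [|t]; rewrite inE; [right | case=> ->].
split=> // y x z xy yz.
have [|t te Rt] := min [set x; y; z]; first by exists x; left; left.
have [Rx Ry Rz] : [/\ R t x, R t y & R t z].
  by split; apply: Rt; [left; left | left; right | right].
case: te Rx Ry Rz => [[|]|] -> // Rx Ry Rz.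
  by rewrite (anti x y) // xy.
by rewrite -(anti y z) // yz.
Qed.

Section FiniteMax.
Context {T : choiceType} {R : rel T}.
Hypotheses (Rtrans : transitive R) (Rtot : total R).

Lemma finite_max (A : set T) : finite_set A -> A !=set0 ->
  exists2 m, A m & forall x, A x -> R x m.
Proof.
move=> /finite_seqP[s ->]; elim: s => [|y s IHs] [x] //= _.
have [[z zs]|s0] := pselect ([set` s] !=set0); last first.
  exists y => [|t] /=; first exact: mem_head.
  rewrite inE => /orP[/eqP->|ts]; last by case: s0; exists t.
  by case/orP: (Rtot y y).
have [|m ms maxm] := IHs; first by exists z.
have [ym|my] := orP (Rtot y m).
  exists m => [|t] /=; first by rewrite inE; apply/orP; right.
  by rewrite inE => /orP[/eqP->|] //; exact: maxm.
exists y => [|t] /=; first exact: mem_head.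
rewrite inE => /orP[/eqP->|ts]; first by case/orP: (Rtot y y).
exact: Rtrans (maxm t ts) my.
Qed.

End FiniteMax.

(** * Additive maps between spaces of finite subsets, and cardinals *)

Section FinsubSpaces.
Context {T : choiceType}.
Implicit Types (X Y : finsub T) (A D : set T).

Lemma finsub_addE X Y : val (X + Y)%R = val X `+` val Y.
Proof. by []. Qed.

Lemma finsub_in_add A X Y :
  finsub_in A X -> finsub_in A Y -> finsub_in A (X + Y)%R.
Proof.
by move=> XA YA x; rewrite finsub_addE => -[[/XA]|[/YA]].
Qed.

Definition finsub1 (x : T) : finsub T := Finsub (finite_set1 x).

(* With [T] well ordered and tops taken outside [D] and [D'], the injection
   sends [x] to the least top of [f X] among the [X] with top [x]. If [x < y]
   had the same image, attained at [X] and [Y], then [X + Y] would have top [y]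
   and [f (X + Y)] a smaller top. *)
Lemma finsub_quotient_card_le (f : finsub T -> finsub T) (A D A' D' : set T) :
  (forall X Y, f (X + Y)%R = (f X + f Y)%R) ->
  (forall X, finsub_in A X -> finsub_in A' (f X)) ->
  (forall X, finsub_in A X -> finsub_in D' (f X) -> finsub_in D X) ->
  A `\` D #<= A' `\` D'.
Proof.
move=> fD fA fD'; have [R [Rrefl Rtrans Ranti Rtot Rmin]] := well_order_ex T.
pose top (B : set T) x X := [/\ B x, val X x & forall t, val X t -> B t -> R t x].
have top_ex B X : val X `&` B !=set0 -> exists x, top B x X.
  move=> XB0; have finXB : finite_set (val X `&` B).
    exact: finite_setIl (finsubP X).
  have [x [Xx Bx] xmax] := finite_max Rtrans Rtot finXB XB0.
  by exists x; split=> // t Xt Bt; exact: xmax.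
pose P x c := exists X,
  [/\ finsub_in A X, top (A `\` D) x X & top (A' `\` D') c (f X)].
(* If f X missed A' minus D', it would lie in [D'], forcing X into [D] although x is outside D. *)
have top_im x X : finsub_in A X -> top (A `\` D) x X ->
    exists c, top (A' `\` D') c (f X).
  move=> XA [[Ax Dx] Xx _]; apply: top_ex; apply: contrapT => empty.
  case: Dx; apply: (fD' X) => // y fXy; apply: contrapT => D'y.
  by case: empty; exists y; split=> //; split=> //; exact: (fA X).
have P_ex x : (A `\` D) x -> exists2 c, P x c & forall d, P x d -> R c d.
  move=> ADx; apply: Rmin.
  have XA : finsub_in A (finsub1 x) by move=> y ->; case: ADx.
  have topx : top (A `\` D) x (finsub1 x) by split=> // t -> _.
  by have [c topc] := top_im _ _ XA topx; exists c, (finsub1 x).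
pose h x := if pselect ((A `\` D) x) is left ADx
            then projT1 (cid2 (P_ex x ADx)) else x.
have hP x : (A `\` D) x -> P x (h x) /\ forall d, P x d -> R (h x) d.
  by rewrite /h; case: pselect => // ADx _; case: cid2.
have hinj x y : (A `\` D) x -> (A `\` D) y -> R x y -> h x = h y -> x = y.
  move=> ADx ADy xy hxy.
  have [[X [XA [_ Xx Xmax] [_ fXc fXmax]]] _] := hP _ ADx.
  have [[Y [YA [_ Yy Ymax] [_ fYc fYmax]]] Pmin] := hP _ ADy.
  rewrite hxy in fXc fXmax; apply: contrapT => nxy.
  have nXy : ~ val X y by move=> /Xmax/(_ ADy) yx; apply/nxy/Ranti; rewrite xy.
  have XYA := finsub_in_add XA YA.
  have topXY : top (A `\` D) y (X + Y)%R.
    split=> [//||t]; rewrite finsub_addE; first by right.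
    by case=> [[Xt _] /(Xmax t Xt) tx|[Yt _] /(Ymax t Yt)//]; exact: Rtrans xy.
  (* Minimality of [h y] and maximality in f X and f Y force d = [h y]; but [h y] belongs to both f
     X and f Y, so it cancels in their sum. *)
  have [d topd] := top_im _ _ XYA topXY.
  have cd : R (h y) d by apply: Pmin; exists (X + Y)%R.
  have [A'd XYd _] := topd; move: XYd; rewrite fD finsub_addE => XYd.
  have dc : R d (h y) by case: XYd => [[Xd _]|[Yd _]]; [exact: fXmax | exact: fYmax].
  have e : d = h y by apply: Ranti; rewrite dc.
  by case: XYd => [[_]|[_]]; rewrite e.
rewrite -(card_le_eql (inj_card_eq (f := h) _)); first last.
  move=> x y /set_mem ADx /set_mem ADy hxy; case/orP: (Rtot x y) => xy.
    exact: hinj.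
  exact/esym/hinj.
by apply: subset_card_le => _ [x /hP[[X [_ _ [ADhx _ _]]] _] <-].
Qed.
(** A finite subset is the sum of the singletons of its elements. *)
Lemma finsub_ind (V : set (finsub T)) :
  V 0%R -> (forall X Y, V X -> V Y -> V (X + Y)%R) ->
  forall X, (forall x, val X x -> V (finsub1 x)) -> V X.
Proof.
move=> V0 VD X; have /finite_seqP[s] := finsubP X.
elim: s X => [|y s IHs] X Xs V1.
  by have -> : X = 0%R by apply: val_inj; rewrite Xs set_nil.
have [ys|ys] := boolP (y \in s).
  apply: IHs V1; rewrite Xs; apply/seteqP; split=> x /=; rewrite inE.
    by case/orP=> // /eqP->.
  by move=> ->; rewrite orbT.
have Xy : val X y by rewrite Xs /= mem_head.
have -> : X = (finsub1 y + (finsub1 y + X))%R.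
  (* The opposite on [T] is the identity by definition (characteristic 2). *)
  rewrite addrA -[(finsub1 y + finsub1 y)%R]/(- finsub1 y + finsub1 y)%R.
  by rewrite addNr add0r.
have Xys : val (finsub1 y + X)%R = [set` s].
  rewrite finsub_addE Xs; apply/seteqP; split=> x /=.
    by case=> [[-> /(_ (mem_head _ _))]//|[]]; rewrite inE => /orP[/eqP|].
  move=> xs; right; split; first by rewrite inE xs orbT.
  by move=> xy; rewrite xy (negPf ys) in xs.
apply: VD; first exact: V1.
by apply: (IHs _ Xys) => x; rewrite Xys => xs; apply: V1; rewrite Xs /= inE xs orbT.
Qed.

End FinsubSpaces.

(** * Subgroups and split semidirect products *)

Lemma subgroupP (gT : groupType) (A : set gT) :
  subgroup A <-> A 1 /\ (forall x y, A x -> A y -> A (x * y^-1)).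
Proof.
split=> [[A1 AV]|[A1 AV]].
  split=> [|x y Ax Ay]; first exact: set_mem.
  by apply: set_mem; apply: AV; exact: mem_set.
split=> [|x y /set_mem Ax /set_mem Ay]; first exact: mem_set.
by apply: mem_set; exact: AV.
Qed.

Lemma subgroup_image (gT hT : groupType) (f : gT -> hT) (A : set gT) :
  monoid.monoid_morphism f -> subgroup A -> subgroup (f @` A).
Proof.
move=> [f1 fM] /subgroupP[A1 AV]; apply/subgroupP; split; first by exists 1.
move=> _ _ [x Ax <-] [y Ay <-]; exists (x * y^-1); first exact: AV.
rewrite fM; congr (_ * _); apply: (mulIg (f y)).
by rewrite mulVg -fM mulVg.
Qed.

Lemma subgroup_range (gT hT : groupType) (f : gT -> hT) :
  monoid.monoid_morphism f -> subgroup (range f).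
Proof. by move=> fM; apply: subgroup_image fM _; apply/subgroupP. Qed.

(** The decomposition is a = (a * s(p a)^-1) * s(p a). Multiplicativity of [p] is asked on [A] only,
    because [theta] is controlled only on [Aut_cliques]. *)
Lemma sdprod_split (gT qT : groupType) (A : set gT) (p : gT -> qT) (s : qT -> gT) :
  subgroup A -> (forall x y, A x -> A y -> p (x * y) = p x * p y) ->
  monoid.monoid_morphism s -> (forall q, A (s q)) -> cancel s p ->
  internal_sdprod A (A `&` [set a | p a = 1]) (range s).
Proof.
move=> gA pM sM As sK; have /subgroupP[A1 AV] := gA; have [s1 sMM] := sM.
have AVi x : A x -> A x^-1 by move=> Ax; rewrite -[x^-1]mul1g; exact: AV.
have AM x y : A x -> A y -> A (x * y).
  by move=> Ax Ay; rewrite -[y]invgK; apply: AV => //; exact: AVi.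
have p1 : p 1 = 1 by rewrite -s1 sK.
have pV x : A x -> p x^-1 = (p x)^-1.
  by move=> Ax; apply: (mulIg (p x)); rewrite -pM ?mulVg //; exact: AVi.
split.
- split=> //; last exact: subgroup_range.
  apply/subgroupP; split=> // x y [Ax px] [Ay py]; split; first exact: AV.
  by rewrite /= pM ?pV ?px ?py ?mulgV //; exact: AVi.
- by split=> [x [Ax _]|_ [q _ <-]].
- move=> a n Aa [An pn]; rewrite conjgE; split.
    by apply: AM (AVi _ Aa) (AM _ _ _ _).
  by rewrite /= !pM ?pV ?pn ?mul1g ?mulVg //; [exact: AVi | exact: AM].
- apply/seteqP; split=> [x [[_ px] [q _ sq]]|_ ->]; last by split=> //; exists 1.
  by move: px; rewrite -sq /= sK => ->.
- apply/seteqP; split=> [a Aa|_ [n [An _] [_ [q _ <-] <-]]]; last exact: AM.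
  exists (a * (s (p a))^-1); last first.
    by exists (s (p a)); [exists (p a) | rewrite mulgVK].
  split; first exact: AV.
  by rewrite /= pM ?pV ?sK ?mulgV //; exact: AVi.
Qed.

Lemma sym_image (T : Type) (f : sym T) (A B : set T) :
  f @` A = B <-> forall x, A x <-> B (f x).
Proof.
split=> [<- x|AB].
  by split=> [Ax|[y Ay /(can_inj (sym_funK f)) <-]] //; exists x.
apply/seteqP; split=> [_ [x Ax <-]|x Bx]; first exact/AB.
by exists (f^-1 x); [apply/AB; rewrite symVK | rewrite symVK].
Qed.

(** * Centralizers as a Galois connection, cliques and cells *)

Section Cliques.
Context {W : groupType} {S : set W}.
Implicit Types (A B : set S) (X Y Z : finsub S) (N P : kernel S).

Lemma sub_Cent2 A : A `<=` Cent2 A.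
Proof. by move=> x Ax y yA; exact/commute_sym/yA. Qed.

Lemma Cent_subset A B : A `<=` B -> Cent B `<=` Cent A.
Proof. by move=> AB x Bx y /AB; exact: Bx. Qed.

Lemma Cent3 A : Cent (Cent2 A) = Cent A.
Proof.
apply/seteqP; split; last exact: sub_Cent2.
exact/Cent_subset/sub_Cent2.
Qed.

Lemma Cent2_sub A B : A `<=` Cent2 B -> Cent2 A `<=` Cent2 B.
Proof. by move=> AB; rewrite -[Cent2 B]Cent3; apply/Cent_subset/Cent_subset. Qed.

Lemma sub_Cent A B : A `<=` Cent B <-> RP B A.
Proof. by split=> [AB x y Bx /AB|BA y Ay x Bx]; [exact | exact: BA]. Qed.

(** C(A) is closed under the closure operator C^2 and equals C(C^2(A)), so B inside C(A) gives
    C^2(B) inside C(C^2(A)). *)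
Lemma RP_Cent2 A B : RP A B -> RP (Cent2 A) (Cent2 B).
Proof.
move=> /sub_Cent BA; apply/sub_Cent; rewrite Cent3 -[Cent A]Cent3.
by apply: Cent2_sub; rewrite /Cent2 Cent3.
Qed.

Lemma RP_sub A A' B B' : A' `<=` A -> B' `<=` B -> RP A B -> RP A' B'.
Proof. by move=> AA BB AB x y /AA Ax /BB By; exact: AB. Qed.

Lemma clique_Cent2 X : cliques S X -> RP (Cent2 (val X)) (Cent2 (val X)).
Proof. exact: RP_Cent2. Qed.

Lemma clique1 (s : S) : cliques S (finsub1 s).
Proof. by move=> x y -> ->. Qed.

(** If x in X and y in Y do not lie in a common one of the two cliques, both survive in the
    symmetric difference. Commutation of cliques is thus expressed by addition and [S]_c alone. *)
Lemma clique_add X Y : cliques S X -> cliques S Y ->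
  cliques S (X + Y)%R <-> RP (val X) (val Y).
Proof.
move=> cX cY; split=> [cXY x y Xx Yy|XY x y].
  have [Yx|nYx] := pselect (val Y x); first exact: cY.
  have [Xy|nXy] := pselect (val X y); first exact: cX.
  by apply: cXY; rewrite finsub_addE; [left | right].
rewrite finsub_addE => -[[Xx _]|[Yx _]] [[Xy _]|[Yy _]].
- exact: cX.
- exact: XY.
- exact/commute_sym/XY.
- exact: cY.
Qed.

(* The right-hand side only involves addition and [S]_c, so it is transported by
   every element of Aut([S], [S]_c). *)
Lemma finsub_in_Cent2 X Y : cliques S X ->
  finsub_in (Cent2 (val X)) Y <->
  cliques S Y /\ forall Z, cliques S Z -> cliques S (Z + X)%R -> cliques S (Z + Y)%R.
Proof.
move=> cX; split=> [YX|[cY ZY] y Yy z zX].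
  have cY : cliques S Y := RP_sub YX YX (clique_Cent2 cX).
  split=> // Z cZ /(clique_add cZ cX) ZX; apply/(clique_add cZ cY) => z y Zz Yy.
  by apply: YX => // x Xx; exact/commute_sym/ZX.
(* The singletons of elements z of C(X) suffice as test cliques Z. *)
have cz := @clique1 z; suff : RP (val (finsub1 z)) (val Y) by exact.
apply/(clique_add cz cY); apply: ZY => //; apply/(clique_add cz cX) => _ x -> Xx.
exact/commute_sym/zX.
Qed.

Lemma Aut_cliquesP (f : sym (finsub S)) : Aut_cliques S f <->
  (forall X Y, f (X + Y)%R = (f X + f Y)%R) /\
  (forall X, cliques S X <-> cliques S (f X)).
Proof.
split=> [[fL fc]|[fD fc]].
  split=> [X Y|]; last exact/sym_image.
  by have := fL 1%R X Y; rewrite !scale1r.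
split; last exact/sym_image.
have f0 : f 0%R = 0%R by apply: (@addrI _ (f 0%R)); rewrite -fD !addr0.
move=> a X Y; rewrite fD; congr (_ + _)%R.
by rewrite /GRing.scale /= /finsub_scale; case: eqP.
Qed.

Lemma Aut_cliques_group : subgroup (Aut_cliques S).
Proof.
apply/subgroupP; split; first exact/Aut_cliquesP.
move=> f g /Aut_cliquesP[fD fc] /Aut_cliquesP[gD gc]; apply/Aut_cliquesP.
split=> [X Y|X]; rewrite !sym_mulE.
  by rewrite -fD; congr (f _); apply: (can_inj (sym_funK g)); rewrite gD !symVK.
by rewrite -fc (gc (g^-1 X)) symVK.
Qed.

Lemma Aut_cliquesV (f : sym (finsub S)) : Aut_cliques S f -> Aut_cliques S f^-1.
Proof.
have /subgroupP[A1 AV] := Aut_cliques_group.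
by move=> Af; rewrite -[f^-1]mul1g; exact: AV.
Qed.

Lemma finsub_in_inj A B : finsub_in A = finsub_in B -> A `<=` B.
Proof.
move=> AB x Ax; have : finsub_in A (finsub1 x) by move=> _ ->.
by rewrite AB; exact.
Qed.

Lemma Cel_sub N P : Cel N `<=` Cel P <-> exists2 s, val N s & Cel P s.
Proof.
have [s Ns] := kernel_ex N; have [t Pt] := kernel_ex P.
split=> [NP|[u Nu]].
  by exists s => //; apply: NP; rewrite (CelE Ns); exact: sub_Cent2.
by rewrite (CelE Nu) (CelE Pt) => Pu; apply: Cent2_sub => _ ->.
Qed.

Lemma sub_Cel N : val N `<=` Cel N.
Proof. by move=> s Ns; rewrite (CelE Ns); exact: sub_Cent2. Qed.

Lemma Cel_inj : injective (@Cel W S).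
Proof.
move=> N P; have [s Ns] := kernel_ex N; have [t Pt] := kernel_ex P.
rewrite (CelE Ns) (CelE Pt) => st; rewrite -(kernel_atP Ns) -(kernel_atP Pt).
exact: kernel_atP.
Qed.

Lemma RP_Cel N P : RP (val N) (val P) <-> RP (Cel N) (Cel P).
Proof.
have [s Ns] := kernel_ex N; have [t Pt] := kernel_ex P.
split; last by apply: RP_sub; exact: sub_Cel.
by move=> NP; rewrite (CelE Ns) (CelE Pt); apply: RP_Cent2 => _ _ -> ->; exact: NP.
Qed.

Lemma clique_Cel N : RP (Cel N) (Cel N).
Proof.
by have [s Ns] := kernel_ex N; rewrite (CelE Ns); apply: RP_Cent2 => _ _ -> ->.
Qed.

(** * The action of Aut([S], [S]_c) on cells and kernels *)

Section Aut.
Context {f : sym (finsub S)}.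
Hypothesis Af : Aut_cliques S f.

Let fD : forall X Y, f (X + Y)%R = (f X + f Y)%R.
Proof. by case/Aut_cliquesP: Af. Qed.

Let fc : forall X, cliques S X <-> cliques S (f X).
Proof. by case/Aut_cliquesP: Af. Qed.

Lemma Aut_Cent2 X Y : cliques S X ->
  finsub_in (Cent2 (val X)) Y <-> finsub_in (Cent2 (val (f X))) (f Y).
Proof.
move=> cX; have cfX := (fc X).1 cX.
rewrite !finsub_in_Cent2 // -fc; split=> -[cY ZY]; split=> // Z cZ cZX.
  rewrite -[Z](symVK f) -fD -fc; apply: ZY; first by apply/fc; rewrite symVK.
  by apply/fc; rewrite fD symVK.
by apply/fc; rewrite fD; apply: ZY; [exact: (fc _).1 | rewrite -fD; exact: (fc _).1].
Qed.

(** For s in N, take x in f({s}) with s in f^-1({x}). Since {x} lies in [C^2(f({s}))], f^-1({x})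
    lies in [C^2(s)]; it also contains s, so its closure is C^2(s), and f carries that space to
    [C^2(x)]. *)
Lemma Aut_Cel_ex N : exists P, f @` finsub_in (Cel N) = finsub_in (Cel P).
Proof.
have [s Ns] := kernel_ex N; rewrite (CelE Ns).
have /Aut_cliquesP[gD gc] := Aut_cliquesV Af.
have [x fsx gxs] : exists2 x, val (f (finsub1 s)) x & val (f^-1 (finsub1 x)) s.
  (* Missing s after f^-1 is stable under sums: if it held at every singleton of f({s}), it would
     hold at f({s}), whose preimage is {s}. *)
  apply: contrapT => nx; pose V Z := ~ val (f^-1 Z) s.
  suff : V (f (finsub1 s)) by rewrite /V symKV; exact.
  apply: finsub_ind => [|X Y VX VY|x fsx gxs].
  - rewrite /V; have -> // : f^-1 0%R = 0%R.
    by apply: (@addrI _ (f^-1 0%R)); rewrite -gD !addr0.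
  - by rewrite /V gD finsub_addE => -[[]|[]].
  - by apply: nx; exists x.
have gx_s : finsub_in (Cent2 [set s]) (f^-1 (finsub1 x)).
  apply/(Aut_Cent2 _ (@clique1 s)); rewrite symVK => _ ->; exact: sub_Cent2.
have s_gx : Cent2 [set s] = Cent2 (val (f^-1 (finsub1 x))).
  apply/seteqP; split; apply: Cent2_sub; last exact: gx_s.
  by move=> _ ->; exact: sub_Cent2.
exists (kernel_at x); rewrite (CelE (in_kernel_at x)); apply/sym_image => Y.
rewrite s_gx Aut_Cent2 ?symVK //.
by rewrite -gc; exact: clique1.
Qed.

End Aut.

Definition Aut_kernel (f : sym (finsub S)) (Af : Aut_cliques S f) N : kernel S :=
  projT1 (cid (Aut_Cel_ex Af N)).

Section AutKernel.
Context {f : sym (finsub S)}.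
Hypothesis Af : Aut_cliques S f.

Lemma Aut_kernelP N : f @` finsub_in (Cel N) = finsub_in (Cel (Aut_kernel Af N)).
Proof. by rewrite /Aut_kernel; case: cid. Qed.

Lemma Aut_kernel_uniq N P :
  f @` finsub_in (Cel N) = finsub_in (Cel P) -> Aut_kernel Af N = P.
Proof.
rewrite Aut_kernelP => NP; apply: Cel_inj.
by apply/seteqP; split; apply: finsub_in_inj.
Qed.

Lemma Aut_kernel_sub N P :
  Cel N `<=` Cel P <-> Cel (Aut_kernel Af N) `<=` Cel (Aut_kernel Af P).
Proof.
have fN := (sym_image _ _ _).1 (Aut_kernelP N).
have fP := (sym_image _ _ _).1 (Aut_kernelP P).
split=> NP x Nx.
  have /fN : finsub_in (Cel (Aut_kernel Af N)) (f (f^-1 (finsub1 x))).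
    by rewrite symVK => _ ->.
  move=> /subset_trans/(_ NP)/fP; rewrite symVK; exact.
have /fN/subset_trans/(_ NP)/fP : finsub_in (Cel N) (finsub1 x) by move=> _ ->.
exact.
Qed.

(** Singletons from the two image cells pull back to cliques inside Cel N and Cel P, which commute,
    so their sum is a clique; f turns this into commutation of the singletons. *)
Lemma Aut_kernel_RP N P :
  RP (val N) (val P) -> RP (val (Aut_kernel Af N)) (val (Aut_kernel Af P)).
Proof.
have fN := (sym_image _ _ _).1 (Aut_kernelP N).
have fP := (sym_image _ _ _).1 (Aut_kernelP P).
have /Aut_cliquesP[fD fc] := Af.
rewrite !RP_Cel => NP x y Nx Py.
have Xx : finsub_in (Cel (Aut_kernel Af N)) (f (f^-1 (finsub1 x))).
  by rewrite symVK => _ ->.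
have Yy : finsub_in (Cel (Aut_kernel Af P)) (f (f^-1 (finsub1 y))).
  by rewrite symVK => _ ->.
move: Xx Yy => /fN Xx /fP Yy.
suff : RP (val (finsub1 x)) (val (finsub1 y)) by exact.
apply/clique_add; [exact: clique1 | exact: clique1 |].
rewrite -[finsub1 x](symVK f) -[finsub1 y](symVK f) -fD -fc.
by apply/clique_add; [exact: RP_sub (@clique_Cel N)
  | exact: RP_sub (@clique_Cel P) | exact: RP_sub NP].
Qed.

End AutKernel.

Lemma Aut_kernelK (f g : sym (finsub S)) (Af : Aut_cliques S f)
  (Ag : Aut_cliques S g) : cancel f g -> cancel (Aut_kernel Af) (Aut_kernel Ag).
Proof.
move=> fK N; apply: Aut_kernel_uniq; rewrite -Aut_kernelP image_comp.
by rewrite (_ : _ \o _ = id) ?image_id //; apply/funext => X; exact: fK.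
Qed.

(* [Cel N `\` N] is the union of the cells strictly contained in [Cel N]. *)
Lemma Aut_kernel_compl (f : sym (finsub S)) (Af : Aut_cliques S f) N X :
  let N' := Aut_kernel Af N in
  finsub_in (Cel N `\` val N) X -> finsub_in (Cel N' `\` val N') (f X).
Proof.
move=> N' XN; pose D' := Cel N' `\` val N'; have /Aut_cliquesP[fD fc] := Af.
suff : [set Y | finsub_in D' (f Y)] X by [].
apply: finsub_ind => [|Y Z YD ZD|x /XN[Nx nNx] y fxy] /=.
- by have -> : f 0%R = 0%R by apply: (@addrI _ (f 0%R)); rewrite -fD !addr0.
- by rewrite fD; exact: finsub_in_add.
have PN : Cel (kernel_at x) `<=` Cel N.
  by apply/Cel_sub; exists x; first exact: in_kernel_at.
have P'N' := (Aut_kernel_sub Af _ _).1 PN.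
have P'y : Cel (Aut_kernel Af (kernel_at x)) y.
  have /sym_image/(_ (finsub1 x))[fx _] := Aut_kernelP Af (kernel_at x).
  by apply: fx fxy => _ ->; exact/sub_Cel/in_kernel_at.
split=> [|N'y]; first exact: P'N'.
(* A y in N' would make the image cells equal, hence also the cells of x and N, although x is
   outside N. *)
apply: nNx; suff <- : kernel_at x = N by exact: in_kernel_at.
apply: Cel_inj; apply/seteqP; split=> //; apply/(Aut_kernel_sub Af)/Cel_sub.
by exists y.
Qed.

(** f induces a map [Cel N]/[Cel N minus N] to [Cel N']/[Cel N' minus N'], injective by
    [Aut_kernel_compl] for f^-1. This gives one inequality; f^-1 gives the other, and
    Cantor-Bernstein concludes. *)
Lemma Aut_kernel_card (f : sym (finsub S)) (Af : Aut_cliques S f) N :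
  val (Aut_kernel Af N) #= val N.
Proof.
have le (g h : sym (finsub S)) (Ag : Aut_cliques S g) (Ah : Aut_cliques S h) P :
    cancel g h -> val P #<= val (Aut_kernel Ag P).
  move=> gK; have /Aut_cliquesP[gD _] := Ag.
  have compl (Q : kernel S) : Cel Q `\` (Cel Q `\` val Q) = val Q.
    by rewrite setDD; apply/setIidPr; exact: sub_Cel.
  rewrite -[X in X #<= _]compl -[X in _ #<= X]compl.
  apply: (finsub_quotient_card_le gD) => X XP.
    exact: ((sym_image _ _ _).1 (Aut_kernelP Ag P) X).1.
  by move=> /(Aut_kernel_compl Ah); rewrite gK (Aut_kernelK Ag Ah gK).
have AV := Aut_cliquesV Af.
rewrite card_eq_le (le _ _ Af AV) ?andbT; last exact: symKV.
rewrite -[X in _ #<= val X](Aut_kernelK Af AV); last exact: symKV.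
by apply: (le _ _ AV Af); exact: symVK.
Qed.

Lemma Aut_kernel_autN (f : sym (finsub S)) : Aut_cliques S f ->
  exists psi : autN S, forall N, f @` finsub_in (Cel N) = finsub_in (Cel (psi N)).
Proof.
move=> Af; have AV := Aut_cliquesV Af.
have fK := Aut_kernelK Af AV (symKV f); have fVK := Aut_kernelK AV Af (symVK f).
have psiP : is_autN S (Sym fK fVK).
  split=> [N P|N]; last exact: Aut_kernel_card.
  split=> [|/(Aut_kernel_RP (Af := AV)) /=]; first exact: Aut_kernel_RP.
  by rewrite !fK.
pose psi : autN S := exist _ (Sym fK fVK) (mem_set psiP).
by exists psi => N; rewrite Aut_kernelP.
Qed.

(** * The homomorphism theta *)

Lemma theta_image (f : sym (finsub S)) N :
  (exists psi : autN S,
    forall P, f @` finsub_in (Cel P) = finsub_in (Cel (psi P))) ->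
  f @` finsub_in (Cel N) = finsub_in (Cel (theta f N)).
Proof. by move=> ex; apply: (xgetPex _ ex). Qed.

Lemma thetaP (f : sym (finsub S)) N : Aut_cliques S f ->
  f @` finsub_in (Cel N) = finsub_in (Cel (theta f N)).
Proof. by move=> Af; exact/theta_image/Aut_kernel_autN. Qed.

Lemma theta_uniq (f : sym (finsub S)) (psi : autN S) :
  (forall N, f @` finsub_in (Cel N) = finsub_in (Cel (psi N))) -> theta f = psi.
Proof.
move=> fpsi; apply: val_inj; apply: symP => N; apply: Cel_inj.
have thN : f @` finsub_in (Cel N) = finsub_in (Cel (theta f N)).
  by apply: theta_image; exists psi.
by apply/seteqP; split; apply: finsub_in_inj; rewrite -thN fpsi.
Qed.

Lemma thetaM (f g : sym (finsub S)) : Aut_cliques S f -> Aut_cliques S g ->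
  theta (f * g) = theta f * theta g.
Proof.
move=> Af Ag; apply: theta_uniq => N.
by rewrite -thetaP // -thetaP // image_comp.
Qed.

End Cliques.

(** * Orders of products of two involutions *)

Section EltOrder.
Context {G : groupType}.
Implicit Types x y : G.

(* Also for an infinite order, encoded by 0. *)
Lemma expg_elt_order x : x ^+ elt_order x = 1.
Proof.
rewrite /elt_order; case: pselect => [ex|_]; last exact: expg0.
by case: ex_minnP => n /andP[_ /eqP].
Qed.

Lemma elt_order_min x n : (0 < n)%N -> x ^+ n = 1 -> (0 < elt_order x <= n)%N.
Proof.
move=> n0 xn; have nP : (0 < n)%N && (x ^+ n == 1) by rewrite n0 xn eqxx.
rewrite /elt_order; case: pselect => [ex|[]]; last by exists n.
by case: ex_minnP => m /andP[-> _] /(_ n nP).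
Qed.

Lemma mul_involution_eq1 x y : y ^+ 2 = 1 -> x * y = 1 -> x = y.
Proof. by rewrite expg2 => yy xy; apply: (mulIg y); rewrite xy yy. Qed.

Lemma mul_involution_expg2 x y : x ^+ 2 = 1 -> y ^+ 2 = 1 ->
  (x * y) ^+ 2 = 1 <-> commute x y.
Proof.
rewrite !expg2 => xx yy; split=> [xyxy|xy].
  by apply: (mulIg (x * y)); rewrite xyxy mulgA -(mulgA y) xx mulg1 yy.
by rewrite {2}xy mulgA -(mulgA x) yy mulg1 xx.
Qed.

End EltOrder.

(** * Automorphisms of Gamma and the section sigma *)

Section Graph.
Context {W : groupType} {S : set W}.
Hypothesis WS : right_angled_coxeter_system S.

(** For involutions, st = 1 means s = t and (st)^2 = 1 means commutation, so the only other allowed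
    order is infinite. The successor of the boolean is 1 on the diagonal, 2 off it. *)
Lemma cox_mxE (s t : S) :
  cox_mx s t = if `[< commute (val s) (val t) >] then (s != t).+1 else 0%N.
Proof.
case: WS => ord2 _ ord _.
have inv (u : S) : val u ^+ 2 = 1 by rewrite -(ord2 _ (set_valP u)) expg_elt_order.
have eq1 : val s * val t = 1 -> s = t.
  by move=> /(mul_involution_eq1 (inv t))/val_inj.
have comm := mul_involution_expg2 (inv s) (inv t).
have expc : (val s * val t) ^+ cox_mx s t = 1 := expg_elt_order _.
case: asboolP => [/comm st2|nst].
  have /andP[] := elt_order_min (isT : 0 < 2)%N st2.
  rewrite -/(cox_mx s t); have [<-|st] := eqVneq s t.
    have /andP[] : (0 < cox_mx s s <= 1)%N.
      by apply: elt_order_min => //; rewrite expg1 -expg2.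
    by case: (cox_mx s s) => [|[]].
  move: expc; case: (cox_mx s t) => [|[|[]]] //.
  by rewrite expg1 => /eq1/eqP; rewrite (negPf st).
have := ord s t; rewrite !inE => /or3P[]/eqP e //; rewrite e in expc.
  by case: nst; rewrite (eq1 expc).
by case: nst; apply/comm.
Qed.

Lemma Aut_GammaP (f : sym S) : Aut_Gamma S f <->
  forall x y, commute (val x) (val y) <-> commute (val (f x)) (val (f y)).
Proof.
split=> fc x y.
  have := fc x y; rewrite !cox_mxE.
  by case: asboolP => ?; case: asboolP => ?.
rewrite !cox_mxE (can_eq (sym_funK f)).
by congr (if _ then _ else _); apply: asbool_equiv_eq; exact: iff_sym (fc x y).
Qed.

Lemma Aut_Gamma_group : subgroup (Aut_Gamma S).
Proof.
apply/subgroupP; split=> // f g fc gc x y.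
by rewrite !sym_mulE fc -(gc (g^-1 x)) !symVK.
Qed.

Lemma sym_finsub_morphism : monoid.monoid_morphism (@sym_finsub S).
Proof.
split=> [|f g]; apply: symP => X; apply: val_inj; first exact: image_id.
by rewrite /= image_comp.
Qed.

Lemma sym_finsub_Aut (f : sym S) : Aut_Gamma S f -> Aut_cliques S (sym_finsub f).
Proof.
move=> /Aut_GammaP fc; apply/Aut_cliquesP; split=> [X Y|X].
  apply: val_inj; rewrite /= /setY; apply/seteqP; split=> [_ [x XYx <-]|].
    case: XYx => -[Xx Yx]; [left | right]; split; try by exists x.
      by case=> y Yy /(can_inj (sym_funK f)) e; apply: Yx; rewrite -e.
    by case=> y Yy /(can_inj (sym_funK f)) e; apply: Yx; rewrite -e.
  by move=> _ [[[x Xx <-] Yx]|[[x Xx <-] Yx]]; exists x => //; [left|right];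
    split=> // Yx'; apply: Yx; exists x.
split=> [cX _ _ [x Xx <-] [y Yy <-]|cX x y Xx Xy].
  by apply: (fc x y).1; exact: cX.
by apply: (fc x y).2; apply: cX; [exists x | exists y].
Qed.

(** f preserves commutation both ways, so it commutes with C and maps C^2(s) onto C^2(f(s)). *)
Lemma Aut_Gamma_Cel (f : sym S) N P : Aut_Gamma S f ->
  (exists2 s, val N s & val P (f s)) ->
  sym_finsub f @` finsub_in (Cel N) = finsub_in (Cel P).
Proof.
move=> /Aut_GammaP fc [s Ns Pfs]; rewrite (CelE Ns) (CelE Pfs).
have cent A x : Cent A x <-> Cent (f @` A) (f x).
  split=> [Ax _ [y Ay <-]|Ax y Ay]; first by apply: (fc y x).1; exact: Ax.
  by apply: (fc y x).2; apply: Ax; exists y.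
have cent_im A : f @` Cent A = Cent (f @` A).
  by apply/sym_image => x; exact: cent.
apply/sym_image => X.
have -> : Cent2 [set f s] = f @` Cent2 [set s] by rewrite /Cent2 !cent_im image_set1.
split=> [XA _ [x Xx <-]|XA x Xx]; first by exists x => //; exact: XA.
have [|y Ay /(can_inj (sym_funK f)) <-] // := XA (f x).
by exists x.
Qed.

Section Sigma.
Variable F : kernel_frame S.

Lemma kernel_at_sigma (psi : autN S) s :
  kernel_at (sigma F psi s) = psi (kernel_at s).
Proof.
have [w [N [x [wN wx ->]]]] := kbij_ex F s.
have kbijN (P : kernel S) : val w P -> val P (kbij F w P x).
  by move=> wP; case: (kbij_bij F wP) => + _ _; exact.
rewrite [sigma F psi _]sigma_funE // (kernel_atP (kbijN _ wN)).
by apply: kernel_atP; apply: kbijN; exact: omega_aut.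
Qed.

(** Commutation of s and t extends to C^2(s) and C^2(t), which contain their kernels. *)
Lemma RP_kernel_at (s t : S) :
  RP (val (kernel_at s)) (val (kernel_at t)) <-> commute (val s) (val t).
Proof.
split=> [|st]; first by apply; exact: in_kernel_at.
rewrite RP_Cel (CelE (in_kernel_at s)) (CelE (in_kernel_at t)).
by apply: RP_Cent2 => _ _ -> ->.
Qed.

Lemma sigma_Aut_Gamma (psi : autN S) : Aut_Gamma S (sigma F psi).
Proof.
apply/Aut_GammaP => x y; rewrite -!RP_kernel_at !kernel_at_sigma.
by case: (set_mem (valP psi)).
Qed.

Lemma sigma_morphism : monoid.monoid_morphism (sigma F).
Proof.
split=> [|psi psi']; apply: symP => s; first exact: sigma_fun1.
exact: sigma_funM.
Qed.

Lemma theta_sigma (psi : autN S) : theta (sym_finsub (sigma F psi)) = psi.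
Proof.
apply: theta_uniq => N; have [s Ns] := kernel_ex N.
apply: Aut_Gamma_Cel (sigma_Aut_Gamma psi) _; exists s => //.
by rewrite -(kernel_atP Ns) -kernel_at_sigma; exact: in_kernel_at.
Qed.

End Sigma.
End Graph.

Theorem proposition8 (W : groupType) (S : set W)
    (WS : right_angled_coxeter_system S) (F : kernel_frame S) :
  let G : set (sym S) := range (sigma F) in
  [/\ forall psi : autN S, Aut_Gamma S (sigma F psi),
      monoid.monoid_morphism (sigma F),
      forall psi : autN S, theta (sym_finsub (sigma F psi)) = psi,
      subgroup G /\ G `<=` Aut_Gamma S
    & internal_sdprod (Aut_cliques S) (K_Gamma S) (@sym_finsub S @` G) /\
      internal_sdprod (@sym_finsub S @` Aut_Gamma S)
        (K_Gamma S `&` (@sym_finsub S @` Aut_Gamma S)) (@sym_finsub S @` G)].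
Proof.
have sG psi := sigma_Aut_Gamma WS F psi.
have [sF1 sFM] := sigma_morphism F; have [sf1 sfM] := sym_finsub_morphism (S := S).
have sM : monoid.monoid_morphism (@sym_finsub S \o sigma F).
  by split=> [|psi psi']; rewrite /= ?sF1 ?sFM.
have thM : forall f g, Aut_cliques S f -> Aut_cliques S g ->
  theta (f * g) = theta f * theta g by exact: thetaM.
split=> //; first exact: theta_sigma.
  by split; [exact: subgroup_range | move=> _ [psi _ <-]].
rewrite image_comp; split.
  apply: (sdprod_split Aut_cliques_group thM sM) => psi; last exact: theta_sigma.
  exact/(sym_finsub_Aut WS).
have gA : subgroup (@sym_finsub S @` Aut_Gamma S).
  by apply: subgroup_image Aut_Gamma_group.
(* This exhibits the normal factor as the kernel of [theta] restricted to Aut(Gamma), the form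
   [sdprod_split] produces. *)
rewrite (_ : K_Gamma S `&` _ =
    (@sym_finsub S @` Aut_Gamma S) `&` [set f | theta f = 1]).
  apply: (sdprod_split gA _ sM) => [f g [f' f'G <-] [g' g'G <-]|psi|psi].
  - by apply: thM; exact: sym_finsub_Aut.
  - by exists (sigma F psi).
  - exact: theta_sigma.
apply/seteqP; split=> [f [[Af thf] Gf]|f [[g gG <-] thf]] //.
by split; [split=> //; exact: sym_finsub_Aut | exists g].
Qed.
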